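(* Let $A\in\mathbb{C}^{n\times n}$ and let $G,H\in\mathbb{C}^{n\times n}$ be Hermitian positive semidefinite. Assume that $\mathbb{R}_{\geq}\neq\emptyset$ and $H\neq 0$. Then the sequence $X_{k+1}=R_{\rm d}(X_k)$, $k\geq 1$, with initial matrix $X_1=H$ converges R-linearly to the minimal positive semidefinite solution $X_\star$ of $X=R_{\rm d}(X)$. Moreover, $$\limsup_{k\to\infty}\sqrt[k]{\|X_k-X_\star\|}\;\leq\;\max\{|\lambda|^2:\ \lambda\in\sigma(T_{X_\star})\cap\mathbb{D}\}<1.$$ When instead $H=0$, one has $X_\star=X_k=0$ for all $k\geq 1$ and $\rho(T_{X_\star})=\rho(A)$.
   Context: Notation: $\mathbb{N}_n$ is the set of $n\times n$ Hermitian positive semidefinite matrices; $\ast$ is conjugate transpose; $M\geq N$ means that $M,N$ are Hermitian and $M-N$ is positive semidefinite; $\sigma(\cdot)$ is the spectrum, $\rho(\cdot)$ the spectral radius; $\mathbb{D}$ is the open unit disk in $\mathbb{C}$; $\|\cdot\|$ is an induced matrix norm. $R_{\rm d}(X):=H+A^\ast X(I+GX)^{-1}A$ (for $X\in\mathbb{N}_n$ the matrix $I+GX$ is invertible), $T_X:=(I+GX)^{-1}A$, and $\mathbb{R}_{\geq}:=\{X\in\mathbb{N}_n:\ X\geq R_{\rm d}(X)\}$. The minimal positive semidefinite solution is the solution $X_\star\in\mathbb{N}_n$ of $X=R_{\rm d}(X)$ with $X_\star\leq S$ for every solution $S\in\mathbb{N}_n$. A sequence $X_k$ converges R-linearly to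 $X_\star$ if $\limsup_{k\to\infty}\sqrt[k]{\|X_k-X_\star\|}\leq\sigma$ for some $\sigma\in(0,1)$. *)

(* Defs.v *)
From HB Require Import structures.
From mathcomp Require Import all_boot all_order all_algebra.
From mathcomp Require Import all_classical all_reals all_analysis.
From mathcomp Require Export complex.

Set Implicit Arguments.
Unset Strict Implicit.
Unset Printing Implicit Defensive.

Import Order.TTheory GRing.Theory Num.Theory.

Local Open Scope classical_set_scope.
Local Open Scope ring_scope.
Local Open Scope complex_scope.
Local Open Scope sesquilinear_scope.

Definition cabs (R : realType) (z : R[i]) : R := ComplexField.Normc.normc z.

(* On R[i] the order 0 <= z means that z is real and nonnegative. *)
Definition psdmx (R : realType) (n : nat) (M : 'M[R[i]]_n) : Prop :=
  M \is hermsymmx /\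
  forall x : 'cV[R[i]]_n, 0 <= (x ^t* *m M *m x) ord0 ord0.

Definition loewner_le (R : realType) (n : nat) (N M : 'M[R[i]]_n) : Prop :=
  [/\ M \is hermsymmx, N \is hermsymmx & psdmx (M - N)].

(* For positive semidefinite G and X the matrix I + G X is invertible, so
   invmx is then the genuine inverse. *)
Definition Rd (R : realType) (n : nat) (A G H X : 'M[R[i]]_n) : 'M[R[i]]_n :=
  H + A ^t* *m X *m invmx (1%:M + G *m X) *m A.

Definition TX (R : realType) (n : nat) (A G X : 'M[R[i]]_n) : 'M[R[i]]_n :=
  invmx (1%:M + G *m X) *m A.

Definition Rge (R : realType) (n : nat) (A G H : 'M[R[i]]_n) :
    set 'M[R[i]]_n :=
  [set X | psdmx X /\ loewner_le (Rd A G H X) X].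

Definition psd_solution (R : realType) (n : nat) (A G H : 'M[R[i]]_n) :
    set 'M[R[i]]_n :=
  [set X | psdmx X /\ X = Rd A G H X].

Definition min_psd_solution (R : realType) (n : nat)
    (A G H X : 'M[R[i]]_n) : Prop :=
  psd_solution A G H X /\
  forall S : 'M[R[i]]_n, psd_solution A G H S -> loewner_le X S.

Definition spectrum (R : realType) (n : nat) (M : 'M[R[i]]_n) : set R[i] :=
  [set l | eigenvalue M l].

(* The value is 0 when n = 0. *)
Definition spectral_radius (R : realType) (n : nat) (M : 'M[R[i]]_n) : R :=
  sup [set cabs l | l in spectrum M].

Definition open_unit_disk (R : realType) : set R[i] := [set z | cabs z < 1].

Record vector_norm (R : realType) (n : nat) (nu : 'cV[R[i]]_n -> R) : Prop :=
  VectorNorm {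
    vnorm_ge0 : forall x, 0 <= nu x;
    vnorm_eq0 : forall x, nu x = 0 -> x = 0;
    vnormZ : forall a x, nu (a *: x) = cabs a * nu x;
    vnormD : forall x y, nu (x + y) <= nu x + nu y
  }.

Definition induced_norm (R : realType) (n : nat) (nu : 'cV[R[i]]_n -> R)
    (M : 'M[R[i]]_n) : R :=
  sup [set nu (M *m x) | x in [set x : 'cV[R[i]]_n | nu x = 1]].

(* Extended reals make the limsup meaningful without a boundedness proof. *)
Definition limsup_root (R : realType) (n : nat) (N : 'M[R[i]]_n -> R)
    (X : nat -> 'M[R[i]]_n) (L : 'M[R[i]]_n) : \bar R :=
  limn_esup (fun k : nat => (N (X k - L) `^ (k%:R^-1))%:E).

Definition R_linear_cvg (R : realType) (n : nat) (N : 'M[R[i]]_n -> R)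
    (X : nat -> 'M[R[i]]_n) (L : 'M[R[i]]_n) : Prop :=
  exists s : R, [/\ 0 < s, s < 1 & (limsup_root N X L <= s%:E)%E].

Definition is_max (R : realType) (S : set R) (m : R) : Prop :=
  S m /\ ubound S m.

(* Main.v *)
(* The identity Rd Y - Rd X = T_Y^* (E + E M_X E) T_Y with E = Y - X and
   M_X = (I + G X)^-1 G >= 0 makes Rd monotone, so the iterates increase, stay
   below every element of Rge and converge to the minimal solution Xs; for
   T = T_Xs the errors E_k = Xs - X_k satisfy E_(k+1) <= (1 + e) T^* E_k T as
   soon as E_k is small.  Hence E_(k+j) <= (1 + e)^j T^j^* Xs T^j.
   Although T may have eigenvalues outside the open unit disk, Xs vanishes on
   the corresponding generalized eigenvectors: for l with |l| >= 1,
   Xs (T - l) y = 0 implies Xs y = 0.  By Cayley-Hamilton, Xs p(T) = 0 for a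
   polynomial p whose roots are the eigenvalues in the disk, and the Xs-seminorm
   of T^j v obeys the linear recurrence of p, so that it decays like the largest
   of these eigenvalues.  The disk contains an eigenvalue, since otherwise p = 1
   and Xs = 0, whence H = 0. *)
Require Import Defs.
From mathcomp Require Import all_boot all_order all_algebra.
From mathcomp Require Import all_classical all_reals all_analysis.
From mathcomp Require Import complex ring lra.

Set Implicit Arguments.
Unset Strict Implicit.
Unset Printing Implicit Defensive.

Import Order.TTheory GRing.Theory Num.Theory.
Import numFieldNormedType.Exports.

Local Open Scope classical_set_scope.
Local Open Scope ring_scope.
Local Open Scope complex_scope.
Local Open Scope sesquilinear_scope.

Local Notation re := complex.Re.
Local Notation im := complex.Im.

(** * Positive semidefinite quadratic forms *)

Lemma reD (R : realType) (y z : R[i]) : re (y + z) = re y + re z.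
Proof. by case: y; case: z. Qed.

Lemma reN (R : realType) (z : R[i]) : re (- z) = - re z.
Proof. by case: z. Qed.

Lemma re_sum (R : realType) (I : Type) (r : seq I) (P : pred I) (F : I -> R[i]) :
  re (\sum_(i <- r | P i) F i) = \sum_(i <- r | P i) re (F i).
Proof.
elim: r => [|a r IH]; rewrite ?big_nil // !big_cons; case: (P a) => //.
by rewrite reD IH.
Qed.

Lemma reZ (R : realType) (a : R) (z : R[i]) : re (a%:C * z) = a * re z.
Proof. by case: z => x y /=; rewrite mul0r subr0. Qed.

Lemma re_conj (R : realType) (z : R[i]) : re z^* = re z.
Proof. by case: z. Qed.

Lemma cabs_sqr (R : realType) (z : R[i]) : cabs z ^+ 2 = re z ^+ 2 + im z ^+ 2.
Proof. by case: z => a b /=; rewrite sqr_sqrtr // addr_ge0 ?sqr_ge0. Qed.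

Lemma cabs_sqr_conj (R : realType) (z : R[i]) : z^* * z = (cabs z ^+ 2)%:C.
Proof. by rewrite cabs_sqr; case: z => a b; simpc; congr (_ +i* _); ring. Qed.

Lemma cabs_ge0 (R : realType) (z : R[i]) : 0 <= cabs z.
Proof. by case: z => a b; apply: sqrtr_ge0. Qed.

Lemma cabsM (R : realType) (y z : R[i]) : cabs (y * z) = cabs y * cabs z.
Proof. exact: ComplexField.Normc.normcM. Qed.

Lemma cabsD (R : realType) (y z : R[i]) : cabs (y + z) <= cabs y + cabs z.
Proof. exact: le_normcD. Qed.

Lemma cabs0 (R : realType) : cabs (0 : R[i]) = 0.
Proof. exact: ComplexField.Normc.normc0. Qed.

Lemma cabs_sum (R : realType) (I : Type) (r : seq I) (F : I -> R[i]) :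
  cabs (\sum_(i <- r) F i) <= \sum_(i <- r) cabs (F i).
Proof.
elim: r => [|a r IH]; rewrite ?big_nil ?cabs0 // !big_cons.
by apply: le_trans (cabsD _ _) _; rewrite lerD2l.
Qed.

Lemma cabs_eq0 (R : realType) (z : R[i]) : cabs z = 0 -> z = 0.
Proof. exact: ComplexField.Normc.eq0_normc. Qed.

Lemma cabsN (R : realType) (z : R[i]) : cabs (- z) = cabs z.
Proof. exact: normcN. Qed.

Lemma cabs_conj (R : realType) (z : R[i]) : cabs z^* = cabs z.
Proof. by case: z => a b; rewrite /cabs /= sqrrN. Qed.

Lemma ler_re_cabs (R : realType) (z : R[i]) : re z <= cabs z.
Proof.
apply: le_trans (ler_norm _) _; rewrite -(ler_pXn2r (ltn0Sn 1)) ?nnegrE //.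
  by rewrite cabs_sqr -normrX ger0_norm ?sqr_ge0 // lerDl sqr_ge0.
exact: cabs_ge0.
Qed.

Lemma adjM (R : realType) m n p (A : 'M[R[i]]_(m, n)) (B : 'M[R[i]]_(n, p)) :
  (A *m B)^t* = B^t* *m A^t*.
Proof. by rewrite trmx_mul map_mxM. Qed.

Lemma adjD (R : realType) m n (A B : 'M[R[i]]_(m, n)) :
  (A + B)^t* = A^t* + B^t*.
Proof. by rewrite linearD /= map_mxD. Qed.

Lemma adjB (R : realType) m n (A B : 'M[R[i]]_(m, n)) :
  (A - B)^t* = A^t* - B^t*.
Proof. by rewrite linearB /= map_mxB. Qed.

Lemma adjK (R : realType) m n (A : 'M[R[i]]_(m, n)) : A^t* ^t* = A.
Proof. exact: trmxCK. Qed.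

Lemma adjZ (R : realType) m n a (A : 'M[R[i]]_(m, n)) :
  (a *: A)^t* = a^* *: A^t*.
Proof. by rewrite linearZ /= map_mxZ. Qed.

Lemma hermP (R : realType) n (M : 'M[R[i]]_n) :
  reflect (M^t* = M) (M \is hermsymmx).
Proof.
by rewrite is_hermitianmxE expr0 scale1r eq_sym; apply: eqP.
Qed.

Definition bf (R : realType) (n : nat) (M : 'M[R[i]]_n) (x y : 'cV[R[i]]_n) : R[i] :=
  (x^t* *m M *m y) ord0 ord0.

Definition qf (R : realType) (n : nat) (M : 'M[R[i]]_n) (x : 'cV[R[i]]_n) : R :=
  re (bf M x x).

(** The real part of the trace. On positive semidefinite matrices it dominates all entries and the
    whole form, so this one number measures the error of the iteration. *)
Definition trq (R : realType) (n : nat) (M : 'M[R[i]]_n) : R :=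
  \sum_i qf M (delta_mx i ord0).

Lemma qfD (R : realType) n (M N : 'M[R[i]]_n) x : qf (M + N) x = qf M x + qf N x.
Proof. by rewrite /qf /bf mulmxDr mulmxDl mxE reD. Qed.

Lemma qfB (R : realType) n (M N : 'M[R[i]]_n) x : qf (M - N) x = qf M x - qf N x.
Proof. by rewrite /qf /bf mulmxBr mulmxBl !mxE reD reN. Qed.

Lemma qf0 (R : realType) n (x : 'cV[R[i]]_n) : qf 0 x = 0.
Proof. by rewrite /qf /bf mulmx0 mul0mx mxE. Qed.

Lemma qf_congr (R : realType) n (B M : 'M[R[i]]_n) x :
  qf (B^t* *m M *m B) x = qf M (B *m x).
Proof. by rewrite /qf /bf adjM !mulmxA. Qed.

Lemma qfZr (R : realType) n (M : 'M[R[i]]_n) a x :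
  qf M (a *: x) = cabs a ^+ 2 * qf M x.
Proof.
rewrite /qf /bf adjZ -scalemxAl -scalemxAl -scalemxAr scalerA mulrC.
by rewrite mulrC cabs_sqr_conj mxE reZ.
Qed.

Lemma bfDl (R : realType) n (M : 'M[R[i]]_n) x y z :
  bf M (x + y) z = bf M x z + bf M y z.
Proof. by rewrite /bf adjD !mulmxDl mxE. Qed.

Lemma bfDr (R : realType) n (M : 'M[R[i]]_n) x y z :
  bf M x (y + z) = bf M x y + bf M x z.
Proof. by rewrite /bf mulmxDr mxE. Qed.

Lemma bfZr (R : realType) n (M : 'M[R[i]]_n) x a y :
  bf M x (a *: y) = a * bf M x y.
Proof. by rewrite /bf -scalemxAr mxE. Qed.

Lemma bf_conj (R : realType) n (M : 'M[R[i]]_n) (x y : 'cV[R[i]]_n) :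
  M^t* = M -> bf M y x = (bf M x y)^*.
Proof.
move=> hM; rewrite /bf; have -> : y^t* *m M *m x = (x^t* *m M *m y)^t*.
  by rewrite !adjM hM adjK mulmxA.
by rewrite mxE mxE.
Qed.

(** A Hermitian form equals its conjugate on the diagonal, hence is real there, and testing real
    parts suffices. *)
Lemma psdmxP (R : realType) n (M : 'M[R[i]]_n) :
  psdmx M <-> M^t* = M /\ forall x, 0 <= qf M x.
Proof.
split=> -[hM pM]; split; first exact/hermP.
- by move=> x; have := pM x; rewrite lecE => /andP[].
- exact/hermP.
- move=> x; rewrite lecE -/(bf M x x) -/(qf M x) pM andbT.
  have := bf_conj x x hM; case: (bf M x x) => a b [/eqP].
  by rewrite -addr_eq0 -mulr2n mulrn_eq0.
Qed.

(* Otherwise [done] tries to decide hermitian symmetry by computation. *)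
Opaque psdmx.

Lemma psd_adj (R : realType) n (M : 'M[R[i]]_n) : psdmx M -> M^t* = M.
Proof. by move=> /psdmxP[]. Qed.

Lemma psd_ge0 (R : realType) n (M : 'M[R[i]]_n) x : psdmx M -> 0 <= qf M x.
Proof. by move=> /psdmxP[_]. Qed.

Lemma psdD (R : realType) n (M N : 'M[R[i]]_n) :
  psdmx M -> psdmx N -> psdmx (M + N).
Proof.
move=> /psdmxP[hM pM] /psdmxP[hN pN]; apply/psdmxP; split.
  by rewrite adjD hM hN.
by move=> x; rewrite qfD addr_ge0.
Qed.

Lemma psd_congr (R : realType) n (B M : 'M[R[i]]_n) :
  psdmx M -> psdmx (B^t* *m M *m B).
Proof.
move=> /psdmxP[hM pM]; apply/psdmxP; split.
  by rewrite !adjM adjK hM mulmxA.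
by move=> x; rewrite qf_congr.
Qed.

Lemma psd0 (R : realType) n : psdmx (0 : 'M[R[i]]_n).
Proof.
by apply/psdmxP; split=> [|x]; rewrite ?qf0 // trmx0 map_mx0.
Qed.

Lemma loewnerP (R : realType) n (N M : 'M[R[i]]_n) :
  psdmx N -> psdmx (M - N) -> loewner_le N M.
Proof.
move=> pN pMN; split => //; apply/hermP; last exact: psd_adj.
by rewrite -[M](subrK N); apply: psd_adj; apply: psdD.
Qed.

Lemma qfDr (R : realType) n (M : 'M[R[i]]_n) x y : M^t* = M ->
  qf M (x + y) = qf M x + qf M y + 2 * re (bf M x y).
Proof.
move=> hM; rewrite /qf bfDl !bfDr (bf_conj x y hM).
by case: (bf M x x) (bf M x y) (bf M y y) => [a ?] [b ?] [c ?] /=; ring.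
Qed.

Lemma psd_CauchySchwarz (R : realType) n (M : 'M[R[i]]_n) x y : psdmx M ->
  cabs (bf M x y) ^+ 2 <= qf M x * qf M y.
Proof.
move=> pM; have hM := psd_adj pM.
set b := bf M x y.
(* The form at [x - s b^* y], with [s] real, is a nonnegative quadratic polynomial in [s]. *)
have key (s : R) :
    0 <= qf M x - 2 * s * cabs b ^+ 2 + s ^+ 2 * cabs b ^+ 2 * qf M y.
  have := psd_ge0 (x + (- s%:C * b^*) *: y) pM; rewrite qfDr // qfZr.
  have -> : re (bf M x ((- s%:C * b^*) *: y)) = - (s * cabs b ^+ 2).
    rewrite bfZr -/b.
    have -> : - s%:C * b^* * b = - (s%:C * (b^* * b)) by ring.
    by rewrite cabs_sqr_conj reN reZ.
  rewrite cabsM exprMn cabsN cabs_conj.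
  have -> : cabs s%:C ^+ 2 = s ^+ 2 by rewrite cabs_sqr /= expr0n addr0.
  move: (qf M x) (qf M y) (cabs b ^+ 2) => u v c.
  by congr (0 <= _); ring.
move: key (psd_ge0 y pM); move: (qf M x) (qf M y) (cabs b ^+ 2) => u v c key.
rewrite le_eqVlt => /orP[/eqP v0|vp].
  (* For [v = 0] the polynomial is affine in [s]; this [s] gives it the value -1 unless [c = 0]. *)
  rewrite -v0 mulr0; have := key ((u + 1) / 2 / c).
  have [->//|c0] := eqVneq c 0.
  rewrite -v0; have -> : u - 2 * ((u + 1) / 2 / c) * c
      + ((u + 1) / 2 / c) ^+ 2 * c * 0 = -1 by field.
  by rewrite ler0N1.
(* For [v > 0] the minimum over [s] is attained at [1 / v]. *)
have := key v^-1.
have -> : u - 2 * v^-1 * c + v^-1 ^+ 2 * c * v = (u * v - c) / v.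
  by field; rewrite gt_eqF.
by rewrite pmulr_lge0 ?invr_gt0 // subr_ge0.
Qed.

Lemma bf_delta (R : realType) n (v : 'cV[R[i]]_n) i :
  ((delta_mx i ord0 : 'cV[R[i]]_n)^t* *m v) ord0 ord0 = v i ord0.
Proof.
rewrite trmx_delta map_delta_mx mxE (bigD1 i) //= mxE !eqxx mul1r.
by rewrite big1 ?addr0 // => j ji; rewrite mxE (negbTE ji) andbF mul0r.
Qed.

Lemma bf_delta2 (R : realType) n (M : 'M[R[i]]_n) i j :
  bf M (delta_mx i ord0) (delta_mx j ord0) = M i j.
Proof. by rewrite /bf -mulmxA bf_delta -colE mxE. Qed.

(** Cauchy-Schwarz against each coordinate vector kills each coordinate of [M *m y]. This turns
    scalar identities into kernel statements. *)
Lemma psd_qf_eq0 (R : realType) n (M : 'M[R[i]]_n) y :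
  psdmx M -> qf M y = 0 -> M *m y = 0.
Proof.
move=> pM y0; apply/matrixP=> i j; rewrite ord1 [RHS]mxE.
apply: cabs_eq0; apply/eqP; rewrite -sqrf_eq0 eq_le sqr_ge0 andbT.
rewrite -bf_delta mulmxA -(mulr0 (qf M (delta_mx i ord0))) -y0.
exact: psd_CauchySchwarz.
Qed.

Lemma qf_ker (R : realType) n (M : 'M[R[i]]_n) y : M *m y = 0 -> qf M y = 0.
Proof. by move=> My; rewrite /qf /bf -mulmxA My mulmx0 mxE. Qed.

Lemma trq_ge (R : realType) n (M : 'M[R[i]]_n) i :
  psdmx M -> qf M (delta_mx i ord0) <= trq M.
Proof.
move=> pM; rewrite /trq (bigD1 i) //= lerDl sumr_ge0 // => j _.
exact: psd_ge0.
Qed.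

Lemma trq_ge0 (R : realType) n (M : 'M[R[i]]_n) : psdmx M -> 0 <= trq M.
Proof. by move=> pM; apply: sumr_ge0 => i _; apply: psd_ge0. Qed.

Lemma psd_entry_le_trq (R : realType) n (M : 'M[R[i]]_n) i j :
  psdmx M -> cabs (M i j) <= trq M.
Proof.
move=> pM; rewrite -(ler_pXn2r (ltn0Sn 1)) ?nnegrE ?cabs_ge0 ?trq_ge0 //.
rewrite -bf_delta2 (le_trans (psd_CauchySchwarz _ _ pM)) //.
by rewrite expr2 ler_pM ?psd_ge0 ?trq_ge.
Qed.

Definition nsq (R : realType) (n : nat) (x : 'cV[R[i]]_n) : R :=
  \sum_i cabs (x i ord0) ^+ 2.

Lemma qfE (R : realType) n (M : 'M[R[i]]_n) x :
  qf M x = \sum_j \sum_i re ((x i ord0)^* * M i j * x j ord0).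
Proof.
rewrite /qf /bf mxE re_sum; apply: eq_bigr => j _.
rewrite mxE mulr_suml re_sum; apply: eq_bigr => i _.
by rewrite mxE mxE.
Qed.

(** The form has [n ^ 2] terms, each at most [trq M * nsq x]. The constant is crude, but only its
    independence of [M] and [x] matters. *)
Lemma qf_le_trq (R : realType) n (M : 'M[R[i]]_n) x : psdmx M ->
  qf M x <= (n ^ 2)%:R * trq M * nsq x.
Proof.
move=> pM; rewrite qfE.
have sq_le i : cabs (x i ord0) ^+ 2 <= nsq x.
  by rewrite /nsq (bigD1 i) //= lerDl sumr_ge0 // => j _; apply: sqr_ge0.
have le_term i j : re ((x i ord0)^* * M i j * x j ord0) <= trq M * nsq x.
  apply: le_trans (ler_re_cabs _) _; rewrite !cabsM cabs_conj.
  rewrite mulrAC mulrC ler_pM ?mulr_ge0 ?cabs_ge0 ?psd_entry_le_trq //.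
  have := sq_le i; have := sq_le j; have := sqr_ge0 (cabs (x i ord0) - cabs (x j ord0)).
  lra.
apply: le_trans (_ : \sum_(j < n) \sum_(i < n) trq M * nsq x <= _).
  by apply: ler_sum => j _; apply: ler_sum => i _.
rewrite !sumr_const card_ord -mulrnA mulnn -mulrA mulr_natl //.
Qed.

(** Coordinatewise Cauchy-Schwarz. The factor [trq E] is what makes terms quadratic in the error
    negligible against [qf E x]. *)
Lemma nsq_mulmx_le (R : realType) n (E : 'M[R[i]]_n) x : psdmx E ->
  nsq (E *m x) <= trq E * qf E x.
Proof.
move=> pE; rewrite /nsq /trq mulr_suml; apply: ler_sum => i _.
by rewrite -bf_delta mulmxA psd_CauchySchwarz.
Qed.

(** * The Riccati operator *)

Section Riccati.
Variables (R : realType) (n : nat).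
Implicit Types (A G H X Y Z : 'M[R[i]]_n) (v : 'cV[R[i]]_n).

Lemma unitmx_of_ker (B : 'M[R[i]]_n) :
  (forall v, B *m v = 0 -> v = 0) -> B \in unitmx.
Proof.
move=> kB; rewrite -unitmx_tr -row_free_unit -kermx_eq0; apply/eqP.
apply/row_matrixP => i; rewrite row0.
have /sub_kermxP : (row i (kermx B^T) <= kermx B^T)%MS by apply: row_sub.
move: (row i _) => u uB.
by rewrite -[u]trmxK (kB u^T) ?trmx0 // -[B]trmxK -trmx_mul uB trmx0.
Qed.

(** If [v = - G X v], then [qf X v = - qf G (X v)], so both sides vanish; hence [X v = 0] and
    [v = 0]. *)
Lemma unit_one_plus G X : psdmx G -> psdmx X -> 1%:M + G *m X \in unitmx.
Proof.
move=> pG pX; apply: unitmx_of_ker => v.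
rewrite mulmxDl mul1mx => /eqP; rewrite addr_eq0 => /eqP vE.
suff Xv : X *m v = 0 by rewrite vE -mulmxA Xv mulmx0 oppr0.
apply: (psd_qf_eq0 pX); apply/eqP; rewrite eq_le psd_ge0 // andbT -oppr_ge0.
have -> : - qf X v = qf G (X *m v); last exact: psd_ge0.
rewrite /qf -reN; congr re; rewrite /bf adjM (psd_adj pX).
have vX : v^t* *m X *m G *m (X *m v) = - (v^t* *m X *m v).
  by rewrite [in RHS]vE mulmxN opprK -[in RHS]vE !mulmxA.
by rewrite vX [in RHS]mxE.
Qed.

Definition Jinv G X := invmx (1%:M + G *m X).

Lemma mulJinv G X : psdmx G -> psdmx X -> (1%:M + G *m X) *m Jinv G X = 1%:M.
Proof. by move=> pG pX; rewrite mulmxV ?unit_one_plus. Qed.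

Lemma mulVJinv G X : psdmx G -> psdmx X -> Jinv G X *m (1%:M + G *m X) = 1%:M.
Proof. by move=> pG pX; rewrite mulVmx ?unit_one_plus. Qed.

Lemma adj_Jinv G X : psdmx G -> psdmx X -> (Jinv G X)^t* = Jinv X G.
Proof.
move=> pG pX; rewrite /Jinv trmx_inv map_invmx.
by rewrite linearD /= map_mxD trmx1 map_mx1 adjM !psd_adj.
Qed.

(** Push-through identity, read off from [(I + X G) X = X (I + G X)]. *)
Lemma mul_JinvC G X : psdmx G -> psdmx X -> Jinv X G *m X = X *m Jinv G X.
Proof.
move=> pG pX; apply: (can_inj (mulKmx (unit_one_plus pX pG))).
rewrite mulmxA mulJinv // mul1mx mulmxA.
have -> : (1%:M + X *m G) *m X = X *m (1%:M + G *m X).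
  by rewrite mulmxDl mulmxDr mul1mx mulmx1 mulmxA.
by rewrite -mulmxA mulJinv // mulmx1.
Qed.

Lemma psd_mul_Jinv G X : psdmx G -> psdmx X -> psdmx (X *m Jinv G X).
Proof.
move=> pG pX.
have -> : X *m Jinv G X
    = (Jinv G X)^t* *m (X + X^t* *m G *m X) *m Jinv G X.
  rewrite (adj_Jinv pG pX) (psd_adj pX).
  have -> : X + X *m G *m X = (1%:M + X *m G) *m X by rewrite mulmxDl mul1mx.
  by rewrite mulmxA (mulVJinv pX pG) mul1mx.
exact/psd_congr/psdD/psd_congr.
Qed.

(** The matrix called M_X above: the weight of the second order term in a difference of two values
    of [Rd]. *)
Definition gain G X := Jinv G X *m G.

Lemma gainE G X : psdmx G -> psdmx X -> gain G X = G *m Jinv X G.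
Proof. by move=> pG pX; rewrite /gain mul_JinvC. Qed.

Lemma psd_gain G X : psdmx G -> psdmx X -> psdmx (gain G X).
Proof. by move=> pG pX; rewrite (gainE pG pX); exact: psd_mul_Jinv. Qed.

(** The difference is [G X G (I + X G)^-1], rewritten as a congruence. It bounds the second order
    term uniformly in [X]. *)
Lemma gain_le G X : psdmx G -> psdmx X -> psdmx (G - gain G X).
Proof.
move=> pG pX.
have -> : G - gain G X = (Jinv X G)^t* *m
    (G^t* *m X *m G + (X *m G)^t* *m G *m (X *m G)) *m Jinv X G.
  rewrite (adj_Jinv pX pG) adjM (psd_adj pG) (psd_adj pX).
  have -> : G *m X *m G + G *m X *m G *m (X *m G)
      = (1%:M + G *m X) *m (G *m X *m G) by rewrite mulmxDl mul1mx !mulmxA.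
  rewrite (mulmxA (Jinv G X)) (mulVJinv pG pX) mul1mx.
  have -> : G *m X *m G *m Jinv X G
      = G *m ((1%:M + X *m G) *m Jinv X G - Jinv X G).
    by rewrite mulmxDl mul1mx addrC addKr !mulmxA.
  by rewrite (mulJinv pX pG) mulmxBr mulmx1 (gainE pG pX).
apply: psd_congr; apply: psdD; exact: psd_congr.
Qed.

(** Holds because [I + M_X (Y - X) = (I + G X)^-1 (I + G Y)]. *)
Lemma TX_shift A G X Y : psdmx G -> psdmx X -> psdmx Y ->
  TX A G X = (1%:M + gain G X *m (Y - X)) *m TX A G Y.
Proof.
move=> pG pX pY; rewrite /TX -/(Jinv G X) -/(Jinv G Y).
have -> : 1%:M + gain G X *m (Y - X) = Jinv G X *m (1%:M + G *m Y).
  rewrite /gain -{1}(mulVJinv pG pX) -mulmxA -mulmxDr mulmxBr.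
  by rewrite -addrA [G *m X + _]addrC subrK.
have -> : Jinv G X *m (1%:M + G *m Y) *m (Jinv G Y *m A)
    = Jinv G X *m ((1%:M + G *m Y) *m Jinv G Y) *m A by rewrite !mulmxA.
by rewrite (mulJinv pG pY) mulmx1.
Qed.

(** A resolvent-type identity puts [Y - X] between the adjoint of [TX A G Y] and [TX A G X];
    [TX_shift] then replaces the latter, so that a congruence by [TX A G Y] alone remains. *)
Lemma Rd_sub A G H X Y : psdmx G -> psdmx X -> psdmx Y ->
  Rd A G H Y - Rd A G H X = (TX A G Y)^t* *m
    ((Y - X) + (Y - X)^t* *m gain G X *m (Y - X)) *m TX A G Y.
Proof.
move=> pG pX pY.
have -> : (Y - X) + (Y - X)^t* *m gain G X *m (Y - X)
    = (Y - X) *m (1%:M + gain G X *m (Y - X)).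
  by rewrite adjB (psd_adj pX) (psd_adj pY) [RHS]mulmxDr mulmx1 !mulmxA.
rewrite (mulmxA _ (Y - X)) -(mulmxA _ _ (TX A G Y)) -(TX_shift A pG pX pY).
rewrite /TX adjM.
rewrite -/(Jinv G Y) -/(Jinv G X) (adj_Jinv pG pY).
rewrite /Rd opprD addrACA subrr add0r -/(Jinv G Y) -/(Jinv G X).
have -> : A^t* *m Jinv Y G *m (Y - X) *m (Jinv G X *m A)
    = A^t* *m (Jinv Y G *m (Y - X) *m Jinv G X) *m A by rewrite !mulmxA.
have -> : Jinv Y G *m (Y - X) *m Jinv G X = Y *m Jinv G Y - X *m Jinv G X.
  have -> : Y - X = Y *m (1%:M + G *m X) - (1%:M + Y *m G) *m X.
    rewrite mulmxDr mulmxDl mulmx1 mul1mx mulmxA.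
    by rewrite [X + _]addrC opprD addrA addrK.
  rewrite mulmxBr mulmxBl; congr (_ - _).
    by rewrite -!mulmxA (mulJinv pG pX) mulmx1 (mul_JinvC pG pY).
  by rewrite mulmxA (mulVJinv pY pG) mul1mx.
by rewrite mulmxBr mulmxBl !mulmxA.
Qed.

Lemma Rd0 A G H : Rd A G H 0 = H.
Proof. by rewrite /Rd !mulmx0 !mul0mx addr0. Qed.

Lemma psd_sub0 X : psdmx X -> psdmx (X - 0).
Proof. by rewrite subr0. Qed.

Lemma psd_Rd_sub A G H X Y : psdmx G -> psdmx X -> psdmx Y -> psdmx (Y - X) ->
  psdmx (Rd A G H Y - Rd A G H X).
Proof.
move=> pG pX pY pE; rewrite (Rd_sub A H pG pX pY).
exact/psd_congr/psdD/psd_congr/psd_gain.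
Qed.

Lemma psd_Rd_ge A G H X : psdmx G -> psdmx X -> psdmx (Rd A G H X - H).
Proof.
move=> pG pX; rewrite -[X in _ - X](Rd0 A G).
apply: (psd_Rd_sub A H pG (@psd0 R n) pX); exact: psd_sub0.
Qed.

Lemma psd_Rd A G H X : psdmx G -> psdmx H -> psdmx X -> psdmx (Rd A G H X).
Proof.
move=> pG pH pX; rewrite -[Rd _ _ _ _](subrK H); apply: psdD pH.
exact: psd_Rd_ge.
Qed.

Lemma qf_Rd_sub A G H X Y v : psdmx G -> psdmx X -> psdmx Y ->
  qf (Rd A G H Y - Rd A G H X) v =
  qf (Y - X) (TX A G Y *m v) + qf (gain G X) ((Y - X) *m (TX A G Y *m v)).
Proof.
by move=> pG pX pY; rewrite (Rd_sub A H pG pX pY) qf_congr qfD qf_congr.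
Qed.

(** The difference formula at [X = 0], where the gain is [G] itself. *)
Lemma qf_Rd A G H Y v : psdmx G -> psdmx Y ->
  qf (Rd A G H Y) v = qf H v + qf Y (TX A G Y *m v) + qf G (Y *m (TX A G Y *m v)).
Proof.
move=> pG pY; have := qf_Rd_sub A H v pG (@psd0 R n) pY.
rewrite Rd0 qfB subr0 /gain /Jinv mulmx0 addr0 invmx1 mul1mx => /eqP.
by rewrite subr_eq => /eqP ->; rewrite addrC addrA.
Qed.

(* The quadratic term of [qf_Rd_sub] is controlled by the trace of [Y - X], so
   it is negligible once [X] is close to [Y]. *)
Lemma qf_Rd_sub_le A G H X Y v : psdmx G -> psdmx X -> psdmx Y ->
  psdmx (Y - X) ->
  qf (Rd A G H Y - Rd A G H X) v <=
  (1 + (n ^ 2)%:R * trq G * trq (Y - X)) * qf (Y - X) (TX A G Y *m v).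
Proof.
move=> pG pX pY pE; rewrite (qf_Rd_sub A H v pG pX pY) mulrDl mul1r lerD2l.
set w := TX A G Y *m v; apply: le_trans (_ : qf G ((Y - X) *m w) <= _).
  by rewrite -subr_ge0 -qfB; apply: psd_ge0; exact: gain_le.
apply: le_trans (qf_le_trq _ pG) _; rewrite -!mulrA.
rewrite ler_wpM2l // ler_wpM2l ?trq_ge0 //; exact: nsq_mulmx_le.
Qed.

End Riccati.

(** * Orbits of a matrix annihilated by a polynomial modulo a kernel *)

Section LinearRecurrence.
Variables (R : realType) (n : nat).
Implicit Types (T X : 'M[R[i]]_n) (rs : seq R[i]) (y : 'cV[R[i]]_n).

(** This is [p(T) y] for the monic polynomial [p] with root list [rs], kept as a product of factors
    so that single roots can be removed. *)
Definition ann T rs y := foldr (fun l z => T *m z - l *: z) y rs.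

Lemma ann_shift T rs l y :
  ann T rs (T *m y - l *: y) = T *m ann T rs y - l *: ann T rs y.
Proof.
elim: rs => //= l' rs ->; move: (ann T rs y) => z.
rewrite !mulmxBr -!scalemxAr !scalerBr !scalerA [l' * l]mulrC.
by rewrite opprD addrACA -opprD.
Qed.

Lemma ann_mulmx T rs y : ann T rs (T *m y) = T *m ann T rs y.
Proof. by have := ann_shift T rs 0 y; rewrite !scale0r !subr0. Qed.

Lemma iter_shift T l y j : iter j (mulmx T) (T *m y - l *: y) =
  T *m iter j (mulmx T) y - l *: iter j (mulmx T) y.
Proof.
elim: j => //= j ->; move: (iter j _ y) => z.
by rewrite mulmxBr -scalemxAr.
Qed.

(** An outermost factor with a rejected root is cancelled by the hypothesis; one with a kept root is
    moved onto the vector, since the factors commute. *)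
Lemma ann_filter T X (p : pred R[i]) rs y :
  (forall l (z : 'cV[R[i]]_n), ~~ p l -> X *m (T *m z - l *: z) = 0 -> X *m z = 0) ->
  X *m ann T rs y = 0 -> X *m ann T [seq l <- rs | p l] y = 0.
Proof.
move=> peel; elim: rs y => //= l rs IH y.
have [pl|npl] := boolP (p l) => /= H0; last exact/IH/(peel l).
by rewrite -ann_shift; apply: IH; rewrite ann_shift.
Qed.

(** Young's inequality: expanding the form at [y - e x] bounds the cross term. *)
Lemma qf_young X (e : R) x y : psdmx X -> 0 < e ->
  qf X (x + y) <= (1 + e) * qf X x + (1 + e^-1) * qf X y.
Proof.
move=> pX e0; have hX := psd_adj pX.
rewrite (qfDr _ _ hX); have := psd_ge0 ((- e%:C) *: x + y) pX.
rewrite (qfDr _ _ hX) qfZr.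
have -> : bf X (- e%:C *: x) y = - (e%:C * bf X x y).
  rewrite (bf_conj _ _ hX) bfZr (bf_conj x y hX) rmorphM rmorphN /= conjcK.
  by rewrite oppr0 mulNr.
have -> : cabs (- e%:C) ^+ 2 = e ^+ 2 by rewrite cabs_sqr /= oppr0 expr0n addr0 sqrrN.
rewrite reN reZ; move: (qf X x) (qf X y) (re _) => a b c H.
suff : 0 <= (e ^+ 2 * a + b + 2 * - (e * c)) / e.
  have -> : (e ^+ 2 * a + b + 2 * - (e * c)) / e = e * a + e^-1 * b - 2 * c.
    by field; rewrite gt_eqF.
  by lra.
by rewrite divr_ge0 // ltW.
Qed.

(** The constant [C] in front of [mu ^+ j] satisfies [c C + L <= mu C], which closes the
    induction. *)
Lemma geometric_recurrence (a : nat -> R) c mu L : 0 <= c -> c < mu ->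
    0 <= L -> (forall j, 0 <= a j) ->
    (forall j, a j.+1 <= c * a j + L * mu ^+ j) ->
  forall j, a j <= (a 0%N + L / (mu - c)) * mu ^+ j.
Proof.
move=> c0 cmu L0 a0 arec; have mc : 0 < mu - c by rewrite subr_gt0.
have mu0 : 0 < mu by apply: le_lt_trans cmu.
elim=> [|j IH]; first by rewrite expr0 mulr1 lerDl divr_ge0 // ltW.
apply: le_trans (arec j) _.
apply: le_trans (_ : c * ((a 0%N + L / (mu - c)) * mu ^+ j) + L * mu ^+ j <= _).
  by rewrite lerD2r ler_wpM2l.
rewrite mulrA -mulrDl exprS [X in _ <= X]mulrA ler_pM2r ?exprn_gt0 //.
have -> : (a 0%N + L / (mu - c)) * mu
    = c * (a 0%N + L / (mu - c)) + L + (mu - c) * a 0%N.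
  by field; rewrite gt_eqF.
by rewrite lerDl mulr_ge0 // ltW.
Qed.

(* If [X] annihilates the polynomial in [T] with roots [rs], then along an orbit
   of [T] the seminorm of [X] satisfies a linear recurrence with roots [rs]. *)
Lemma qf_orbit_le T X (mu : R) rs y : psdmx X -> 0 < mu ->
    (forall l, l \in rs -> cabs l ^+ 2 < mu) ->
    (forall j, X *m ann T rs (iter j (mulmx T) y) = 0) ->
  exists K, 0 <= K /\ forall j, qf X (iter j (mulmx T) y) <= K * mu ^+ j.
Proof.
move=> pX mu0; elim: rs y => [|l rs IH] y lt_mu Xann.
  by exists 0; split=> // j; rewrite mul0r (qf_ker (Xann j)).
have [|j|L [L0 hL]] := IH (T *m y - l *: y).
- by move=> z zrs; apply: lt_mu; rewrite inE zrs orbT.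
- by rewrite iter_shift ann_shift; exact: Xann.
have lmu : cabs l ^+ 2 < mu by apply: lt_mu; rewrite inE eqxx.
set c := cabs l ^+ 2 in lmu; have c0 : 0 <= c by apply: sqr_ge0.
(* Chosen so that [(1 + e) c] stays below the midpoint of [c] and [mu]; the [+ 1] covers [c = 0]. *)
pose e := (mu - c) / (2 * (c + 1)).
have e0 : 0 < e by rewrite divr_gt0 ?subr_gt0 // mulr_gt0 // ltr_wpDl.
have ce : (1 + e) * c < mu.
  have -> : (1 + e) * c = c + (mu - c) / 2 * (c / (c + 1)).
    by rewrite /e; field; rewrite gt_eqF // ltr_wpDl.
  apply: le_lt_trans (_ : c + (mu - c) / 2 * 1 < mu); last by lra.
  rewrite lerD2l ler_wpM2l //; first by rewrite divr_ge0 // subr_ge0 ltW.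
  by rewrite ler_pdivrMr ?ltr_wpDl // mul1r lerDl.
pose a j := qf X (iter j (mulmx T) y).
have a0 j : 0 <= a j by exact: psd_ge0.
have L'0 : 0 <= (1 + e^-1) * L by rewrite mulr_ge0 // addr_ge0 // invr_ge0 ltW.
exists (a 0%N + (1 + e^-1) * L / (mu - (1 + e) * c)); split.
  by rewrite addr_ge0 // divr_ge0 // subr_ge0 ltW.
apply: (geometric_recurrence (a := a)) => //.
  by rewrite mulr_ge0 // addr_ge0 // ltW.
(* The next orbit point is [l] times the current one plus a point of the orbit of [T *m y - l *: y],
   bounded by induction. *)
move=> j; rewrite /a /= -(subrK (l *: iter j (mulmx T) y) (T *m _)) addrC.
apply: le_trans (qf_young _ _ pX e0) _.
rewrite qfZr mulrA -/c lerD2l -mulrA ler_wpM2l //.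
  by rewrite addr_ge0 // invr_ge0 ltW.
by rewrite -iter_shift.
Qed.

End LinearRecurrence.

Lemma char_roots (R : realType) n (T : 'M[R[i]]_n) :
  exists rs, (forall l, eigenvalue T l = (l \in rs)) /\ forall y, ann T rs y = 0.
Proof.
case: n T => [|p] T.
  exists [::]; split=> [l|y]; last by rewrite flatmx0.
  by apply/negbTE; rewrite /eigenvalue negbK flatmx0.
have [rs] := closed_field_poly_normal (char_poly T).
rewrite (monicP (char_poly_monic T)) scale1r => chiE; exists rs; split=> [l|y].
  by rewrite eigenvalue_root_char chiE root_prod_XsubC.
have <- : horner_mx T (char_poly T) *m y = ann T rs y.
  rewrite chiE; elim: (rs) => [|l s IH] /=.
    by rewrite big_nil rmorph1 mul1mx.
  rewrite big_cons rmorphM rmorphB /= horner_mx_X horner_mx_C -IH.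
  by rewrite -mulmxE -mulmxA mulmxBl mul_scalar_mx.
by rewrite Cayley_Hamilton mul0mx.
Qed.

(** * Monotone convergence of the iteration *)

Lemma cvg_sum_fin (R : realType) (I : Type) (r : seq I) (f : I -> nat -> R)
    (l : I -> R) :
  (forall i, f i k @[k --> \oo] --> l i) ->
  \sum_(i <- r) f i k @[k --> \oo] --> \sum_(i <- r) l i.
Proof. by move=> fl; apply: cvg_big => [|i _]; [exact: add_continuous|exact: fl]. Qed.

(** Polarization: together with [im_entry] it turns convergence of quadratic forms into convergence
    of entries. *)
Lemma re_entry (R : realType) n (M : 'M[R[i]]_n) i j : M^t* = M ->
  re (M i j) = (qf M (delta_mx i ord0 + delta_mx j ord0)
    - qf M (delta_mx i ord0) - qf M (delta_mx j ord0)) / 2.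
Proof. by move=> hM; rewrite (qfDr _ _ hM) bf_delta2; field. Qed.

Lemma im_entry (R : realType) n (M : 'M[R[i]]_n) i j : M^t* = M ->
  im (M i j) = (qf M (delta_mx i ord0) + qf M (delta_mx j ord0)
    - qf M (delta_mx i ord0 + 'i%C *: delta_mx j ord0)) / 2.
Proof.
move=> hM; rewrite (qfDr _ _ hM) qfZr bfZr bf_delta2 cabs_sqr.
by case: (M i j) => a b /=; field.
Qed.

Lemma re_mul3 (R : realType) (a z b : R[i]) :
  re (a * z * b) = re (a * b) * re z - im (a * b) * im z.
Proof. by case: a z b => [a1 a2] [z1 z2] [b1 b2] /=; ring. Qed.

(** Each [qf (M k) x] is nondecreasing and bounded by [qf Z x]; polarization then yields the limits
    of the entries, which form [L]. *)
Lemma monotone_psd_cvg (R : realType) n (M : nat -> 'M[R[i]]_n) Z :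
    (forall k, psdmx (M k)) -> (forall k, psdmx (M k.+1 - M k)) ->
    (forall k, psdmx (Z - M k)) ->
  exists L, L^t* = L /\ forall x, qf (M k) x @[k --> \oo] --> qf L x.
Proof.
move=> pM Mle MZ.
have qcvg x : cvgn (fun k => qf (M k) x).
  apply: nondecreasing_is_cvgn.
    apply/nondecreasing_seqP => k; rewrite -subr_ge0 -qfB; exact: psd_ge0.
  exists (qf Z x) => _ [k _ <-]; rewrite -subr_ge0 -qfB; exact: psd_ge0.
have recvg i j : cvgn (fun k => re (M k i j)).
  have -> : (fun k => re (M k i j)) = fun k =>
      (qf (M k) (delta_mx i ord0 + delta_mx j ord0)
       - qf (M k) (delta_mx i ord0) - qf (M k) (delta_mx j ord0)) / 2.
    by apply/funext => k; rewrite re_entry // psd_adj.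
  by apply: is_cvgMl; apply: is_cvgB; [apply: is_cvgB|]; exact: qcvg.
have imcvg i j : cvgn (fun k => im (M k i j)).
  have -> : (fun k => im (M k i j)) = fun k =>
      (qf (M k) (delta_mx i ord0) + qf (M k) (delta_mx j ord0)
       - qf (M k) (delta_mx i ord0 + 'i%C *: delta_mx j ord0)) / 2.
    by apply/funext => k; rewrite im_entry // psd_adj.
  by apply: is_cvgMl; apply: is_cvgB; [apply: is_cvgD|]; exact: qcvg.
pose L : 'M[R[i]]_n := \matrix_(i, j)
  (limn (fun k => re (M k i j)) +i* limn (fun k => im (M k i j))).
exists L; split.
  apply/matrixP => i j; rewrite !mxE.
  have adjE k : M k i j = (M k j i)^*.
    by rewrite -{1}(psd_adj (pM k)) !mxE.
  apply/eqP; rewrite eq_complex /=; apply/andP; split; apply/eqP.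
    by congr (limn _); apply/funext => k; rewrite adjE re_conj.
  rewrite -limN //; congr (limn _); apply/funext => k.
  by rewrite adjE; change (- im (M k j i) = im (M k j i)^*); case: (M k j i).
move=> x; rewrite qfE.
have -> : (fun k => qf (M k) x) = fun k => \sum_j \sum_i
    (re ((x i ord0)^* * x j ord0) * re (M k i j)
     - im ((x i ord0)^* * x j ord0) * im (M k i j)).
  apply/funext => k; rewrite qfE.
  by apply: eq_bigr => j _; apply: eq_bigr => i _; rewrite re_mul3.
apply: cvg_sum_fin => j; apply: cvg_sum_fin => i; rewrite re_mul3 mxE.
by apply: cvgB; apply: cvgMr; [exact: recvg|exact: imcvg].
Qed.

(** Continuity of [Rd] at [Y] from below in quantitative form: the bound vanishes with
    [trq (Y - X)]. *)
Lemma trq_Rd_sub_le (R : realType) n (A G H X Y : 'M[R[i]]_n) :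
  psdmx G -> psdmx X -> psdmx Y -> psdmx (Y - X) ->
  trq (Rd A G H Y - Rd A G H X) <=
  (1 + (n ^ 2)%:R * trq G * trq (Y - X)) *
    ((n ^ 2)%:R * trq (Y - X) * \sum_i nsq (TX A G Y *m delta_mx i ord0)).
Proof.
move=> pG pX pY pE; rewrite [leLHS]/trq.
set a := 1 + _; set b := _ * trq _; rewrite !mulr_sumr.
apply: ler_sum => i _; apply: le_trans (qf_Rd_sub_le A H _ pG pX pY pE) _.
apply: ler_wpM2l; last exact: qf_le_trq.
rewrite addr_ge0 // mulr_ge0 //; last exact: trq_ge0.
by rewrite mulr_ge0 //; exact: trq_ge0.
Qed.

Section RiccatiIteration.
Variables (R : realType) (n : nat) (A G H : 'M[R[i]]_n).
Variable X : nat -> 'M[R[i]]_n.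
Hypotheses (pG : psdmx G) (pH : psdmx H).
Hypotheses (X0 : X 0 = H) (XS : forall k, X k.+1 = Rd A G H (X k)).

Lemma iterate_psd k : psdmx (X k).
Proof. by elim: k => [|k IH]; [rewrite X0|rewrite XS; exact: psd_Rd]. Qed.

Lemma iterate_mono k : psdmx (X k.+1 - X k).
Proof.
elim: k => [|k IH]; first by rewrite XS X0; exact: psd_Rd_ge.
rewrite (XS k.+1) [M in _ - M](XS k).
exact: (psd_Rd_sub A H pG (iterate_psd k) (iterate_psd k.+1) IH).
Qed.

(** By monotonicity, [Z >= Rd Z >= Rd (X k)] as soon as [Z >= X k]. *)
Lemma iterate_le Z k : psdmx Z -> psdmx (Z - Rd A G H Z) -> psdmx (Z - X k).
Proof.
move=> pZ ZR; elim: k => [|k IH].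
  rewrite X0 -(subrKA (Rd A G H Z)); apply: (psdD ZR); exact: psd_Rd_ge.
rewrite XS -(subrKA (Rd A G H Z)); apply: (psdD ZR).
exact: (psd_Rd_sub A H pG (iterate_psd k) pZ IH).
Qed.

(** The last clause, that [Xs] is the least upper bound of the iterates, gives minimality, as every
    solution bounds them by [iterate_le]. *)
Lemma iterate_cvg Z : psdmx Z -> psdmx (Z - Rd A G H Z) ->
  exists Xs, [/\ psdmx Xs, forall k, psdmx (Xs - X k),
    trq (Xs - X k) @[k --> \oo] --> 0, Xs = Rd A G H Xs &
    forall S, psdmx S -> (forall k, psdmx (S - X k)) -> psdmx (S - Xs)].
Proof.
move=> pZ ZR.
have [Xs [hXs qXs]] := monotone_psd_cvg iterate_psd iterate_mono
  (fun k => iterate_le k pZ ZR).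
have hle k x : qf (X k) x <= qf Xs x.
  rewrite -(cvg_lim _ (qXs x)) //; apply: nondecreasing_cvgn_le; last first.
    by apply/cvg_ex; exists (qf Xs x).
  apply/nondecreasing_seqP => j; rewrite -subr_ge0 -qfB; apply: psd_ge0.
  exact: iterate_mono.
have pXs : psdmx Xs.
  apply/psdmxP; split=> // x; apply: le_trans (hle 0%N x).
  exact/psd_ge0/iterate_psd.
have pE k : psdmx (Xs - X k).
  apply/psdmxP; split=> [|x]; last by rewrite qfB subr_ge0.
  by rewrite adjB hXs (psd_adj (iterate_psd k)).
have tr0 : trq (Xs - X k) @[k --> \oo] --> 0.
  have <- : \sum_(i < n) 0 = 0 :> R by rewrite big1.
  apply: cvg_sum_fin => i; rewrite -(subrr (qf Xs (delta_mx i ord0))).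
  have -> : (fun k => qf (Xs - X k) (delta_mx i ord0)) =
     fun k => qf Xs (delta_mx i ord0) - qf (X k) (delta_mx i ord0).
    by apply/funext => k; rewrite qfB.
  by apply: cvgB; [exact: cvg_cst|exact: qXs].
exists Xs; split; [exact: pXs|exact: pE|exact: tr0| |]; last first.
  move=> S pS SX; apply/psdmxP; split=> [|x].
    by rewrite adjB hXs (psd_adj pS).
  rewrite qfB subr_ge0; apply: (ler_cvg_to (qXs x) (cvg_cst _)).
  by apply: nearW => k; rewrite -subr_ge0 -qfB; exact: (psd_ge0 x (SX k)).
apply/eqP; rewrite -subr_eq0; apply/eqP/matrixP => i j; rewrite [RHS]mxE.
apply: cabs_eq0; apply/eqP; rewrite eq_le cabs_ge0 andbT.
set C := \sum_i nsq (TX A G Xs *m delta_mx i ord0).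
pose t k := trq (Xs - X k).
(* Bounds each entry of [Xs - Rd A G H Xs] by splitting it at [X k.+1 = Rd A G H (X k)]. *)
pose f k := t k.+1 +
  (1 + (n ^ 2)%:R * trq G * t k) * ((n ^ 2)%:R * t k * C).
have f0 : f k @[k --> \oo] --> 0.
  have -> : (0 : R) = 0 + (1 + (n ^ 2)%:R * trq G * 0) * ((n ^ 2)%:R * 0 * C).
    by rewrite !(mulr0, mul0r, addr0).
  apply: cvgD; first by rewrite cvg_shiftS.
  apply: cvgM; first by apply: cvgD; [exact: cvg_cst|exact: cvgMr].
  by apply: cvgMl; exact: cvgMr.
apply: (ler_cvg_to (cvg_cst _) f0); apply: nearW => k.
have -> : (Xs - Rd A G H Xs) i j
    = (Xs - X k.+1) i j - (Rd A G H Xs - Rd A G H (X k)) i j.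
  rewrite -XS; move: (Rd A G H Xs) (X k.+1) => U V.
  by rewrite !mxE opprB addrA subrK.
apply: le_trans (cabsD _ _) _; rewrite cabsN; apply: lerD.
  by apply: psd_entry_le_trq; exact: pE.
apply: le_trans (_ : trq (Rd A G H Xs - Rd A G H (X k)) <= _).
  apply: psd_entry_le_trq.
  exact: (psd_Rd_sub A H pG (iterate_psd k) pXs (pE k)).
exact: (trq_Rd_sub_le A H pG (iterate_psd k) pXs (pE k)).
Qed.

End RiccatiIteration.

(** * Rate of convergence *)

Section RiccatiRate.
Variables (R : realType) (n : nat) (A G H : 'M[R[i]]_n).
Variable X : nat -> 'M[R[i]]_n.
Hypotheses (pG : psdmx G) (pH : psdmx H).
Hypotheses (X0 : X 0 = H) (XS : forall k, X k.+1 = Rd A G H (X k)).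
Variable Xs : 'M[R[i]]_n.
Hypotheses (pXs : psdmx Xs) (pE : forall k, psdmx (Xs - X k)).
Hypothesis tr0 : trq (Xs - X k) @[k --> \oo] --> 0.
Hypothesis Xs_fix : Xs = Rd A G H Xs.

Local Notation T := (TX A G Xs).

(** Here [qf Xs y = qf (Xs - X k) y] for all [k], and the right side tends to 0 with the trace. *)
Lemma limit_ker (y : 'cV[R[i]]_n) : (forall k, X k *m y = 0) -> Xs *m y = 0.
Proof.
move=> Xy; apply: (psd_qf_eq0 pXs); apply/eqP; rewrite eq_le psd_ge0 // andbT.
have tr0' : (n ^ 2)%:R * trq (Xs - X k) * nsq y @[k --> \oo] --> 0.
  rewrite -[Z in _ --> Z](mul0r (nsq y)) -[Z in Z * _](mulr0 (n ^ 2)%:R).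
  by apply: cvgMl; apply: cvgMr.
apply: (ler_cvg_to (cvg_cst _) tr0'); apply: nearW => k.
rewrite -[leLHS]subr0 -(qf_ker (Xy k)) -qfB; exact: (qf_le_trq y (pE k)).
Qed.

Lemma iterate_ker k (y : 'cV[R[i]]_n) : Xs *m y = 0 -> X k *m y = 0.
Proof.
move=> Xy; have pX := iterate_psd pG pH X0 XS k.
apply: (psd_qf_eq0 pX); apply/eqP; rewrite eq_le psd_ge0 // andbT.
by rewrite -(qf_ker Xy) -subr_ge0 -qfB; exact: (psd_ge0 y (pE k)).
Qed.

(* Modulo the kernel of [Xs], the matrix [T] has no eigenvalue outside the open
   disk: there [Xs = H + T^* Xs T + (Xs T)^* G (Xs T)] forces [|l| = 1], [H y = 0]
   and [A y = l y], so that every iterate, hence [Xs], annihilates [y]. *)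
Lemma limit_peel l (y : 'cV[R[i]]_n) : 1 <= cabs l -> Xs *m (T *m y - l *: y) = 0 ->
  Xs *m y = 0.
Proof.
move=> l1 Xz; set z := T *m y - l *: y in Xz.
have Ty : T *m y = l *: y + z by rewrite addrC subrK.
have XTy : Xs *m (T *m y) = l *: (Xs *m y) by rewrite Ty mulmxDr Xz addr0 scalemxAr.
have qTy : qf Xs (T *m y) = cabs l ^+ 2 * qf Xs y.
  rewrite Ty (qfDr _ _ (psd_adj pXs)) qfZr (qf_ker Xz).
  by rewrite /bf -mulmxA Xz mulmx0 mxE mulr0 !addr0.
have qE : qf Xs y = qf H y + cabs l ^+ 2 * qf Xs y
    + cabs l ^+ 2 * qf G (Xs *m y).
  by rewrite {1}Xs_fix (qf_Rd A H y pG pXs) qTy XTy qfZr.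
have L1 : 1 <= cabs l ^+ 2 by rewrite expr_ge1 // (le_trans ler01).
(* With [q = qf Xs y], [h = qf H y], [g = qf G (Xs y)] and [L = |l|^2], the equation reads
   [h + (L - 1) q + L g = 0], a sum of nonnegative terms. *)
have [h0 g0] : qf H y = 0 /\ qf G (Xs *m y) = 0.
  move: qE L1 (psd_ge0 y pXs) (psd_ge0 y pH) (psd_ge0 (Xs *m y) pG).
  move: (qf Xs y) (qf H y) (qf G _) (cabs l ^+ 2) => q h g L qE L1 q0 h0 g0.
  have Lq : 0 <= (L - 1) * q by rewrite mulr_ge0 ?subr_ge0.
  have Lg : g <= L * g by rewrite ler_peMl.
  by split; lra.
have Hy := psd_qf_eq0 pH h0; have GXy := psd_qf_eq0 pG g0.
have Ay : A *m y = l *: y + z.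
  have -> : A *m y = (1%:M + G *m Xs) *m (T *m y).
    by rewrite /TX mulmxA (mulmxA _ (invmx _)) (mulJinv pG pXs) mul1mx.
  by rewrite mulmxDl mul1mx -(mulmxA G) XTy -scalemxAr GXy scaler0 addr0.
(* By push-through, [X k] can be applied directly to [A y = l y + z]; it kills [y] by induction and
   [z] because [Xs z = 0]. *)
apply: limit_ker; elim=> [|k IH]; first by rewrite X0.
have pX := iterate_psd pG pH X0 XS k.
rewrite XS /Rd mulmxDl Hy add0r -(mulmxA _ A) Ay -(mulmxA _ (X k)).
rewrite -/(Jinv G (X k)) -(mul_JinvC pG pX) -!mulmxA mulmxDr -scalemxAr IH.
by rewrite (iterate_ker k Xz) scaler0 addr0 !mulmx0.
Qed.

(** In the Cayley-Hamilton product, [limit_peel] cancels every factor whose root is outside the open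
    disk. *)
Lemma limit_ann : exists rs,
  (forall l, (l \in rs) = eigenvalue T l && (cabs l < 1)) /\
  forall y : 'cV[R[i]]_n, Xs *m ann T rs y = 0.
Proof.
have [rs [rsE ann0]] := char_roots T.
exists [seq l <- rs | cabs l < 1]; split=> [l|y].
  by rewrite mem_filter andbC rsE.
apply: ann_filter; last by rewrite ann0 mulmx0.
by move=> l z; rewrite -leNgt; exact: limit_peel.
Qed.

(** From [k0] on, each step costs a factor [1 + e] and one application of [T]; the error at [k0] is
    at most [Xs]. *)
Lemma qf_error_iter_le e k0 : 0 <= e ->
    (forall k, (k0 <= k)%N -> (n ^ 2)%:R * trq G * trq (Xs - X k) <= e) ->
  forall j v, qf (Xs - X (k0 + j)%N) v <=
    (1 + e) ^+ j * qf Xs (iter j (mulmx T) v).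
Proof.
move=> e0 small; elim=> [|j IH] v.
  rewrite expr0 mul1r addn0 qfB gerBl; apply: psd_ge0.
  exact: (iterate_psd pG pH X0 XS).
have pX := iterate_psd pG pH X0 XS (k0 + j)%N.
rewrite addnS XS {1}Xs_fix.
apply: le_trans (qf_Rd_sub_le A H v pG pX pXs (pE _)) _.
apply: le_trans (_ : (1 + e) * qf (Xs - X (k0 + j)%N) (T *m v) <= _).
  apply: ler_wpM2r; first exact: (psd_ge0 _ (pE _)).
  by rewrite lerD2l small // leq_addr.
rewrite exprS -mulrA iterSr; apply: ler_wpM2l; last exact: IH.
by rewrite addr_ge0.
Qed.

Lemma error_rate m s : 0 <= m -> m < s ->
    (forall l, eigenvalue T l -> cabs l < 1 -> cabs l ^+ 2 <= m) ->
  exists K, 0 <= K /\ \forall k \near \oo, trq (Xs - X k) <= K * s ^+ k.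
Proof.
move=> m0 ms eigm; have [rs [rsE ann0]] := limit_ann.
(* The room between [m] and [s] is shared: orbits of [T] decay at rate [mu], and [1 + e = s / mu]
   absorbs the second order term. *)
pose mu := (m + s) / 2; have mmu : m < mu by rewrite /mu; lra.
have mu0 : 0 < mu by apply: le_lt_trans mmu.
have s0 : 0 < s by apply: le_lt_trans ms.
pose e := s / mu - 1; have e0 : 0 < e.
  by rewrite subr_gt0 ltr_pdivlMr // mul1r /mu; lra.
have emu : (1 + e) * mu = s by rewrite /e addrC subrK divfK // gt_eqF.
have orbits (i : 'I_n) : exists K, 0 <= K /\
    forall j, qf Xs (iter j (mulmx T) (delta_mx i ord0)) <= K * mu ^+ j.
  apply: (qf_orbit_le (rs := rs) pXs mu0) => [l|j]; last exact: ann0.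
  by rewrite rsE => /andP[el l1]; apply: le_lt_trans mmu; exact: eigm.
have [K hK] := choice orbits.
pose c := (n ^ 2)%:R * trq G.
have ctr0 : c * trq (Xs - X k) @[k --> \oo] --> 0.
  by rewrite -(mulr0 c); apply: cvgMr.
have [k0 _ small] := cvgr_le _ ctr0 _ e0.
(* Dividing by [s ^+ k0] compensates for starting the estimate at [k0]. *)
exists ((\sum_i K i) / s ^+ k0); split.
  apply: divr_ge0; last by rewrite exprn_ge0 // ltW.
  by apply: sumr_ge0 => i _; case: (hK i).
exists k0 => // k /= k0k; rewrite -(subnKC k0k); set j := (k - k0)%N.
have -> : (\sum_i K i) / s ^+ k0 * s ^+ (k0 + j) = \sum_i (K i * s ^+ j).
  by rewrite exprD mulrA divfK ?mulr_suml // expf_neq0 // gt_eqF.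
apply: ler_sum => i _.
apply: le_trans (qf_error_iter_le (ltW e0) small _ _) _.
rewrite -emu exprMn [leRHS]mulrCA; apply: ler_wpM2l.
  by rewrite exprn_ge0 // addr_ge0 // ltW.
by case: (hK i).
Qed.

End RiccatiRate.

(** * Equivalence of norms *)

Section NormBounds.
Variables (R : realType) (n : nat) (nu : 'cV[R[i]]_n -> R).
Hypothesis hnu : vector_norm nu.

Let e_ i : 'cV[R[i]]_n := delta_mx i ord0.

Lemma vnorm0 : nu 0 = 0.
Proof. by rewrite -(scale0r (0 : 'cV_n)) (vnormZ hnu) cabs0 mul0r. Qed.

Lemma vnorm_sum (I : Type) (r : seq I) (F : I -> 'cV[R[i]]_n) :
  nu (\sum_(i <- r) F i) <= \sum_(i <- r) nu (F i).
Proof.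
elim: r => [|a r IH]; rewrite ?big_nil ?vnorm0 // !big_cons.
by apply: le_trans (vnormD hnu _ _) _; rewrite lerD2l.
Qed.

Lemma vnorm_le_coord x : nu x <= \sum_i cabs (x i ord0) * nu (e_ i).
Proof.
have {1}-> : x = \sum_i x i ord0 *: e_ i.
  by rewrite {1}[x]matrix_sum_delta; apply: eq_bigr => i _; rewrite big_ord1.
apply: le_trans (vnorm_sum _ _) _.
by apply: ler_sum => i _; rewrite (vnormZ hnu).
Qed.

(* The coordinate space is seen as real of dimension [n + n], where the unit
   sphere is compact. *)
Let toC (v : 'rV[R]_(n + n)) : 'cV[R[i]]_n :=
  \col_i (v ord0 (lshift n i) +i* v ord0 (rshift n i)).

Let toCB v w : toC (v - w) = toC v - toC w.
Proof. by apply/matrixP => i j; rewrite !mxE. Qed.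

Let toCZ (a : R) v : toC (a *: v) = a%:C *: toC v.
Proof.
by apply/matrixP => i j; rewrite !mxE; simpc.
Qed.

Let cabs_le_reim (z : R[i]) : cabs z <= `|re z| + `|im z|.
Proof.
rewrite -(ler_pXn2r (ltn0Sn 1)) ?nnegrE ?cabs_ge0 ?addr_ge0 //.
rewrite cabs_sqr sqrrD !real_normK ?num_real // -addrA lerD2l lerDr.
by rewrite mulrn_wge0 // mulr_ge0.
Qed.

Let coord_le_norm (v : 'rV[R]_(n + n)) j : `|v ord0 j| <= `|v|.
Proof.
by rewrite {2}/Num.Def.normr /= mx_normrE; apply: (le_bigmax _ _ (ord0, j)).
Qed.

Let cabs_toC v i : cabs (toC v i ord0) <= 2 * `|v|.
Proof.
apply: le_trans (cabs_le_reim _) _; rewrite mxE /= mulr2n mulrDl mul1r.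
by apply: lerD; exact: coord_le_norm.
Qed.

Let vnorm_toC v : nu (toC v) <= (2 * \sum_i nu (e_ i)) * `|v|.
Proof.
apply: le_trans (vnorm_le_coord _) _.
rewrite mulrAC mulr_sumr; apply: ler_sum => i _.
by apply: ler_wpM2r; [exact: vnorm_ge0|exact: cabs_toC].
Qed.

Let vnorm_toC_continuous : continuous (nu \o toC).
Proof.
move=> v; apply/(@cvgrPdist_le _ _ _ (nbhs v)) => e e0 /=.
set B := 2 * \sum_i nu (e_ i).
have B0 : 0 <= B.
  by rewrite mulr_ge0 // sumr_ge0 // => i _; exact: vnorm_ge0.
have lip w z : nu (toC w) - nu (toC z) <= B * `|w - z|.
  rewrite lerBlDr; apply: le_trans (lerD (vnorm_toC (w - z)) (lexx _)).
  by apply: le_trans (vnormD hnu _ _); rewrite toCB subrK.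
near=> w.
have vw : B * `|v - w| <= e.
  apply: le_trans (_ : (B + 1) * `|v - w| <= _).
    by rewrite ler_wpM2r // lerDl.
  rewrite mulrC -ler_pdivlMr ?ltr_wpDl //.
  near: w; apply: cvgr_dist_le; first exact: cvg_id.
  by rewrite divr_gt0 // ltr_wpDl.
rewrite ler_norml; apply/andP; split; last exact: le_trans (lip _ _) vw.
rewrite lerNl opprB; apply: le_trans (lip _ _) _.
by rewrite distrC.
Unshelve. all: by end_near.
Qed.

Let toC_surj x : exists v, toC v = x.
Proof.
exists (row_mx (\row_i re (x i ord0)) (\row_i im (x i ord0))).
apply/matrixP => i j; rewrite mxE row_mxEl row_mxEr !mxE.
have -> : j = ord0 by exact: ord1.
by case: (x i ord0).
Qed.

Let toC_eq0 v : toC v = 0 -> v = 0.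
Proof.
move=> /matrixP v0; apply/matrixP => k j; rewrite [RHS]mxE.
have -> : k = ord0 by exact: ord1.
rewrite -(splitK j); case: (fintype.split j) => i /=;
  have := v0 i ord0; rewrite !mxE => /eqP; rewrite eq_complex /=.
- by move=> /andP[/eqP].
- by move=> /andP[_ /eqP].
Qed.

(** On the compact real unit sphere [nu] attains a positive minimum; homogeneity extends the bound
    to all vectors. *)
Lemma cabs_coord_le_vnorm :
  exists c, 0 <= c /\ forall (x : 'cV[R[i]]_n) i, cabs (x i ord0) <= c * nu x.
Proof.
pose S := [set v : 'rV[R]_(n + n) | `|v| = 1].
have cS : compact S.
  apply: bounded_closed_compact.
    by exists 1; split=> // M M1 v /= ->; exact: ltW.
  have -> : S = (fun v : 'rV[R]_(n + n) => `|v|) @^-1` [set 1] by [].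
  apply: preimage_closed; last exact: closed_eq.
  by move=> v _; exact: norm_continuous.
have nu_ge0 := vnorm_ge0 hnu.
have normalize v : v != 0 -> S (`|v|^-1 *: v).
  move=> v0; rewrite /S /= normrZ normfV normr_id mulVf //.
  by rewrite normr_eq0.
(* An empty sphere means that zero is the only vector, as in dimension 0. *)
have [S0|S0] := pselect (S !=set0); last first.
  exists 0; split=> // x i; have [v <-] := toC_surj x.
  have [->|v0] := eqVneq v 0; first by rewrite !mxE mul0r /cabs /= !expr0n addr0 sqrtr0.
  by case: S0; exists (`|v|^-1 *: v); exact: normalize.
have [w wS wmin] := EVT_min_rV S0 cS
  (continuous_subspaceT vnorm_toC_continuous).
have d0 : 0 < nu (toC w).
  rewrite lt_neqAle nu_ge0 andbT eq_sym; apply/eqP => /(vnorm_eq0 hnu)/toC_eq0 w0.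
  move: wS; rewrite inE /S /= w0 normr0 => /esym/eqP.
  by rewrite oner_eq0.
exists (2 / nu (toC w)); split; first by rewrite divr_ge0 // ltW.
move=> x i; have [v <-] := toC_surj x.
apply: le_trans (cabs_toC v i) _; rewrite -mulrA ler_pM2l // mulrC ler_pdivlMr //.
have [->|v0] := eqVneq v 0; first by rewrite normr0 mul0r nu_ge0.
have vp : 0 < `|v| by rewrite normr_gt0.
have /wmin : `|v|^-1 *: v \in S by rewrite inE; exact: normalize.
rewrite /= toCZ (vnormZ hnu) /cabs /= expr0n addr0 sqrtr_sqr normfV normr_id.
by rewrite mulrC ler_pdivlMr // mulrC.
Qed.

Lemma induced_norm_ge0 M : 0 <= induced_norm nu M.
Proof.
rewrite /induced_norm; set S := [set _ | _ in _].
(* A set without supremum gets the default value 0. *)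
have [hS|/sup_out ->//] := pselect (has_sup S).
have [y Sy] := hS.1; apply: le_trans (ub_le_sup hS.2 Sy).
by case: Sy => x _ <-; exact: vnorm_ge0.
Qed.

Lemma induced_norm_le : exists C, 0 <= C /\ forall (M : 'M[R[i]]_n) b, 0 <= b ->
  (forall i j, cabs (M i j) <= b) -> induced_norm nu M <= C * b.
Proof.
have [c [c0 hc]] := cabs_coord_le_vnorm.
have nu_ge0 := vnorm_ge0 hnu.
exists (n%:R * c * \sum_i nu (e_ i)).
have C0 : 0 <= n%:R * c * \sum_i nu (e_ i).
  apply: mulr_ge0; first exact: mulr_ge0.
  by apply: sumr_ge0 => i _; exact: nu_ge0.
split=> // M b b0 hM; rewrite /induced_norm; set S := [set _ | _ in _].
have [S0|S0] := pselect (S !=set0); last first.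
  rewrite sup_out; first exact: mulr_ge0.
  by case.
apply: ge_sup => // _ [x /= x1 <-]; apply: le_trans (vnorm_le_coord _) _.
rewrite mulrAC mulr_sumr; apply: ler_sum => i _; apply: ler_wpM2r => //.
rewrite mxE; apply: le_trans (cabs_sum _ _) _.
apply: le_trans (_ : \sum_(j < n) c * b <= _); last first.
  by rewrite sumr_const card_ord -mulrA mulr_natl.
apply: ler_sum => j _; rewrite cabsM mulrC.
apply: ler_pM; rewrite ?cabs_ge0 ?hM //.
by have := hc x j; rewrite x1 mulr1.
Qed.

End NormBounds.

(** * From geometric bounds to the limsup of roots *)

Lemma near_geometric_le (R : realType) (K s t : R) :
  0 < s -> s < t -> \forall k \near \oo, K * s ^+ k <= t ^+ k.
Proof.
move=> s0 st; have t0 := lt_trans s0 st.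
have q1 : `|s / t| < 1.
  by rewrite ger0_norm ?divr_ge0 ?ltW // ltr_pdivrMr // mul1r.
have Kq : K * (s / t) ^+ k @[k --> \oo] --> 0.
  by rewrite -(mulr0 K); apply: cvgMr; exact: cvg_expr.
near=> k; have : K * (s / t) ^+ k <= 1.
  by near: k; exact: (cvgr_le _ Kq _ ltr01).
by rewrite expr_div_n mulrA ler_pdivrMr ?exprn_gt0 // mul1r.
Unshelve. all: by end_near.
Qed.

(** The limsup is an infimum of suprema over sets of the filter; the set where [u k <= l] is one of
    them. *)
Lemma limn_esup_le (R : realType) (u : nat -> \bar R) (l : \bar R) :
  (\forall k \near \oo, (u k <= l)%E) -> (limn_esup u <= l)%E.
Proof.
move=> ul; rewrite /limn_esup /limf_esup.
apply: le_trans (_ : ereal_sup [set u k | k in [set k | (u k <= l)%E]] <= _)%E.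
  by apply: ereal_inf_lbound; exists [set k | (u k <= l)%E].
by apply: ge_ereal_sup => _ [k /= ukl <-].
Qed.

Lemma limsup_root_le (R : realType) n (N : 'M[R[i]]_n -> R)
    (X : nat -> 'M[R[i]]_n) L m :
    0 <= m -> (forall M, 0 <= N M) ->
    (forall s, m < s -> exists K, \forall k \near \oo, N (X k - L) <= K * s ^+ k) ->
  (limsup_root N X L <= m%:E)%E.
Proof.
move=> m0 N0 rate; apply/lee_addgt0Pr => e e0; rewrite -EFinD.
(* The rate [m + e / 2] leaves room for [K] to be absorbed into [(m + e) ^+ k]. *)
have [|K hK] := rate (m + e / 2); first by lra.
have s0 : 0 < m + e / 2 by lra.
have st : m + e / 2 < m + e by lra.
apply: limn_esup_le; near=> k; rewrite lee_fin.
have k0 : (0 < k)%N by near: k; exact: nbhs_infty_gt.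
have le_pow : N (X k - L) <= (m + e) ^+ k.
  apply: (@le_trans _ _ (K * (m + e / 2) ^+ k)); first by near: k.
  by near: k; exact: near_geometric_le.
have me0 : 0 <= m + e by lra.
apply: le_trans (_ : ((m + e) ^+ k) `^ (k%:R^-1) <= _).
  by apply: ge0_ler_powR; rewrite ?nnegrE ?invr_ge0 ?exprn_ge0.
by rewrite -powR_mulrn // -powRrM mulfV ?powRr1 // pnatr_eq0 -lt0n.
Unshelve. all: by end_near.
Qed.

Lemma seq_argmax (R : realType) (T : eqType) (f : T -> R) (s : seq T) :
  s != [::] -> exists2 x, x \in s & forall y, y \in s -> f y <= f x.
Proof.
elim: s => // a s IH _; have [->|/IH[x xs hx]] := eqVneq s [::].
  by exists a; rewrite ?inE // => y; rewrite inE => /eqP ->.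
have [fax|fxa] := lerP (f a) (f x).
  exists x; first by rewrite inE xs orbT.
  by move=> y; rewrite inE => /orP[/eqP -> //|]; exact: hx.
exists a; first by rewrite inE eqxx.
move=> y; rewrite inE => /orP[/eqP -> //|ys].
exact: le_trans (hx _ ys) (ltW fxa).
Qed.

Lemma TX0 (R : realType) n (A G : 'M[R[i]]_n) : TX A G 0 = A.
Proof. by rewrite /TX mulmx0 addr0 invmx1 mul1mx. Qed.

Lemma riccati_convergence (R : realType) n (A G H : 'M[R[i]]_n)
    (nu : 'cV[R[i]]_n -> R) (X : nat -> 'M[R[i]]_n) :
    vector_norm nu -> psdmx G -> psdmx H -> X 1%N = H ->
    (forall k, (1 <= k)%N -> X k.+1 = Rd A G H (X k)) ->
    Rge A G H !=set0 -> H <> 0 ->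
  exists Xs : 'M[R[i]]_n, min_psd_solution A G H Xs /\
    exists m : R,
      [/\ is_max [set cabs l ^+ 2 |
            l in spectrum (TX A G Xs) `&` @open_unit_disk R] m,
          (limsup_root (induced_norm nu) X Xs <= m%:E)%E & m < 1].
Proof.
move=> hnu pG pH X1 XS [Z [pZ [_ _ ZR]]] H0.
(* The given sequence starts at index 1, the one studied above at index 0. *)
pose Y k := X k.+1.
have YS k : Y k.+1 = Rd A G H (Y k) by rewrite /Y XS.
have [Xs [pXs pE tr0 Xs_fix minXs]] := iterate_cvg pG pH (X1 : Y 0%N = H) YS pZ ZR.
exists Xs; split.
  split; first by split.
  move=> S [pS SR]; apply: (loewnerP pXs); apply: minXs (pS) _ => k.
  apply: (iterate_le pG pH (X1 : Y 0%N = H) YS k pS).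
  rewrite -SR subrr; exact: psd0.
have [rs [rsE ann0]] := limit_ann pG pH (X1 : Y 0%N = H) YS pXs pE tr0 Xs_fix.
have rs0 : rs != [::].
  apply/eqP => rs0; apply: H0.
  have Xs0 : Xs = 0.
    apply/matrixP => i j; have := ann0 (delta_mx j ord0).
    by rewrite rs0 /= -colE => /matrixP/(_ i ord0); rewrite !mxE.
  by rewrite -(Rd0 A G H) -Xs0 -Xs_fix Xs0.
have [l0 l0rs l0max] := seq_argmax (fun l => cabs l ^+ 2) rs0.
move: (l0rs); rewrite rsE => /andP[el0 l01].
have m0 : 0 <= cabs l0 ^+ 2 by exact: sqr_ge0.
exists (cabs l0 ^+ 2); split.
- split; first by exists l0.
  by move=> _ [l [el l1] <-]; apply: l0max; rewrite rsE; apply/andP.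
- apply: limsup_root_le => // [M|s ms]; first exact: induced_norm_ge0.
  have [K [K0 hK]] := error_rate pG pH (X1 : Y 0%N = H) YS pXs pE tr0 Xs_fix m0 ms
    (fun l el l1 => l0max l (etrans (rsE l) (introT andP (conj el l1)))).
  have [C [C0 hC]] := induced_norm_le hnu.
  have s0 : 0 < s := le_lt_trans m0 ms.
  (* Division by [s] accounts for the index shift between [X] and [Y]. *)
  exists (C * (K / s)).
  have [k0 _ hk0] := hK; exists k0.+1 => // -[//|k] /= k0k.
  apply: le_trans (hC _ (trq (Xs - Y k)) _ _) _.
  + exact: (trq_ge0 (pE k)).
  + move=> i j; have -> : (X k.+1 - Xs) i j = - (Xs - Y k) i j.
      by rewrite /Y !mxE opprB.
    rewrite cabsN; exact: (psd_entry_le_trq _ _ (pE k)).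
  + rewrite -mulrA ler_wpM2l // exprS mulrA divfK ?gt_eqF //; exact: hk0.
- by rewrite expr_lt1 // cabs_ge0.
Qed.

Unset Implicit Arguments.

Theorem theorem3p2 (R : realType) (n : nat) (A G H : 'M[R[i]]_n)
    (nu : 'cV[R[i]]_n -> R) (hnu : vector_norm nu)
    (hG : psdmx G) (hH : psdmx H)
    (X : nat -> 'M[R[i]]_n) (hX1 : X 1%N = H)
    (hX : forall k : nat, (1 <= k)%N -> X k.+1 = Rd A G H (X k)) :
  (Rge A G H !=set0 -> H <> 0 ->
     exists Xs : 'M[R[i]]_n,
       [/\ min_psd_solution A G H Xs,
           R_linear_cvg (induced_norm nu) X Xs
         & exists m : R,
             [/\ is_max [set cabs l ^+ 2 |
                          l in spectrum (TX A G Xs) `&` @open_unit_disk R] m,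
                 (limsup_root (induced_norm nu) X Xs <= m%:E)%E
               & m < 1]]) /\
  (H = 0 ->
     exists Xs : 'M[R[i]]_n,
       [/\ min_psd_solution A G H Xs,
           Xs = 0,
           forall k : nat, (1 <= k)%N -> X k = 0
         & spectral_radius (TX A G Xs) = spectral_radius A]).
Proof.
split=> [hZ H0|H0].
  have [Xs [Xs_min [m [m_max m_limsup m1]]]] :=
    riccati_convergence hnu hG hH hX1 hX hZ H0.
  have m0 : 0 <= m by case: m_max => -[l _ <-] _; exact: sqr_ge0.
  exists Xs; split=> //; last by exists m.
  (* The maximum [m] can be 0, whereas the rate must be positive, hence the midpoint of [m] and
     1. *)
  exists ((m + 1) / 2); split; [lra|lra|].
  by apply: le_trans m_limsup _; rewrite lee_fin; lra.
have p0 : psdmx (0 : 'M[R[i]]_n) by exact: psd0.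
have min0 : min_psd_solution A G H 0.
  split; first by rewrite /psd_solution /= Rd0 H0.
  by move=> S [pS _]; apply: (loewnerP p0); exact: psd_sub0.
have X0 : forall k, (1 <= k)%N -> X k = 0.
  elim=> // -[|k] IH _; first by rewrite hX1.
  by rewrite hX // IH // Rd0.
exists 0; split; [exact: min0|by []|exact: X0|].
by rewrite TX0.
Qed.
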